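(* For a class $\mathscr C$ of graphs we have the following equivalences: (1) $\mathscr C$ is locally monadically dependent if and only if $\mathscr C$ is monadically dependent; (2) $\mathscr C$ is locally monadically straight if and only if $\mathscr C$ is monadically straight; (3) $\mathscr C$ is locally monadically stable if and only if $\mathscr C$ is monadically stable.
   Context: Graphs are finite, undirected and loopless; a class of graphs is a set of graphs considered up to isomorphism, and every class contains the empty graph. For a set $\mathcal U$ of unary relation symbols, a $\mathcal U$-colored graph is a graph with additional unary relations in $\mathcal U$. Formulas are first-order, with adjacency relation $E$. Transductions. For a positive integer $k$, the $k$-copy operation $\mathsf C_k$ maps a graph $G$ to the graph consisting of $k$ copies of $G$ in which the $k$ copies of each vertex are made pairwise adjacent (no other edges between the copies). The coloring operation $\Gamma_{\mathcal U}$ maps a graph to the set of all its $\mathcal U$-expansions. A simple interpretation $\mathsf I=(\nu(x),\eta(x,y))$ of graphs in $\mathcal U$-colored graphs is a pair of first-order formulas with $\eta$ symmetric and anti-reflexive; $\mathsf I(G^+)$ is the graph with vertex set $\nu(G^+)$ and edge set $\eta(G^+)\cap\nu(G^+)^2$. A transduction is a composition $\mathsf T=\mathsf I\circ\Gamma_{\mathcal U}\circ\mathsf C_k$, so $\mathsf T(G)=\{\mathsf I(G^+): G^+\in\Gamma_{\mathcal U}(\mathsf C_k(G))\}$. For a class $\mathscr D$, $\mathsf T(\mathscr D)=\bigcup_{G\in\mathscr D}\mathsf T(G)$ up to isomorphism. $\mathscr C$ is a transduction of $\mathscr D$ if $\mathscr C\subseteq\mathsf T(\mathscr D)$ for some transduction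 $\mathsf T$. Dividing lines. The half-graph $H_n$ is the bipartite graph with parts $\{a_1,\dots,a_n\}$ and $\{b_1,\dots,b_n\}$ in which $a_i$ is adjacent to $b_j$ iff $i\leq j$. A trivially perfect graph is a comparability graph of a forest order, i.e. of a partial order in which every principal downset is linearly ordered. A class $\mathscr C$ is monadically dependent if the class of all graphs is not a transduction of $\mathscr C$; monadically straight if the class of all trivially perfect graphs is not a transduction of $\mathscr C$; monadically stable if the class of all half-graphs is not a transduction of $\mathscr C$. Local versions. For a property $\Pi$ of classes, $\mathscr C$ is locally $\Pi$ if for every integer $d$ the class of all balls $B_d^G(v)$ (subgraph of $G$ induced by the vertices at distance at most $d$ from $v$) with $G\in\mathscr C$, $v\in V(G)$, has property $\Pi$. *)

(* Defs.v *)
From mathcomp Require Import all_boot.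

Set Implicit Arguments.
Unset Strict Implicit.
Unset Printing Implicit Defensive.

Record sgraph := SGraph {
  vertex :> finType;
  edge : rel vertex;
  edge_sym : symmetric edge;
  edge_irr : irreflexive edge }.

Definition graph_iso (G H : sgraph) : Prop :=
  exists2 f : G -> H, bijective f & forall x y, edge (f x) (f y) = edge x y.

Lemma graph_iso_sym G H : graph_iso G H -> graph_iso H G.
Proof.
move=> [f [g fK gK] fE]; exists g; first by exists f.
by move=> x y; rewrite -fE !gK.
Qed.

Lemma graph_iso_trans G H K : graph_iso G H -> graph_iso H K -> graph_iso G K.
Proof.
move=> [f fB fE] [g gB gE]; exists (g \o f); first exact: bij_comp.
by move=> x y /=; rewrite gE fE.
Qed.

Definition empty_graph : sgraph :=
  @SGraph void (fun _ _ => false) (fun _ _ => erefl) (fun _ => erefl).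

Lemma empty_graph_iso (G : sgraph) : (G -> False) -> graph_iso empty_graph G.
Proof.
move=> G0; exists (fun x : void => match x with end); last by case.
by exists (fun x => match G0 x with end) => x; [case: x | case: (G0 x)].
Qed.

(* A class is a set of graphs up to isomorphism, encoded as an
   isomorphism-closed predicate; it always contains the empty graph. *)
Record graph_class := GraphClass {
  in_class :> sgraph -> Prop;
  class_iso : forall G H, graph_iso G H -> in_class G -> in_class H;
  class_empty : in_class empty_graph }.

Record colored_graph (U : Type) := ColoredGraph {
  cg_graph :> sgraph;
  color : U -> pred cg_graph }.

(* [formula U n] : formulas whose free variables are among n variables indexed
   by 'I_n. In [Ex phi] the bound variable is the variable ord0 of phi, and the
   free variable i of [Ex phi] is the variable [lift ord0 i] of phi. *)
Inductive formula (U : Type) : nat -> Type :=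
| Bot n : formula U n
| Eq n of 'I_n & 'I_n : formula U n
| Adj n of 'I_n & 'I_n : formula U n
| Col n of U & 'I_n : formula U n
| Neg n of formula U n : formula U n
| And n of formula U n & formula U n : formula U n
| Or n of formula U n & formula U n : formula U n
| Ex n of formula U n.+1 : formula U n
| All n of formula U n.+1 : formula U n.

Definition env_cons (T : Type) n (v : T) (e : 'I_n -> T) : 'I_n.+1 -> T :=
  fun i => if unlift ord0 i is Some j then e j else v.

Definition env_nil (T : Type) : 'I_0 -> T :=
  fun i => match notF (ltn_ord i) with end.

Fixpoint sat (U : Type) (G : colored_graph U) n (phi : formula U n) :
    ('I_n -> G) -> bool :=
  match phi in formula _ n return ('I_n -> G) -> bool with
  | Bot _ => fun _ => false
  | Eq _ i j => fun e => e i == e j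
  | Adj _ i j => fun e => edge (e i) (e j)
  | Col _ u i => fun e => color u (e i)
  | Neg _ f => fun e => ~~ sat f e
  | And _ f g => fun e => sat f e && sat g e
  | Or _ f g => fun e => sat f e || sat g e
  | Ex _ f => fun e => [exists v : G, sat f (env_cons v e)]
  | All _ f => fun e => [forall v : G, sat f (env_cons v e)]
  end.

Definition sat1 U (G : colored_graph U) (phi : formula U 1) (x : G) : bool :=
  sat phi (env_cons x (@env_nil G)).

Definition sat2 U (G : colored_graph U) (phi : formula U 2) (x y : G) : bool :=
  sat phi (env_cons x (env_cons y (@env_nil G))).

Record simple_interpretation (U : Type) := SimpleInterpretation {
  nu : formula U 1;
  eta : formula U 2;
  eta_sym : forall G : colored_graph U, symmetric (@sat2 U G eta);
  eta_irr : forall G : colored_graph U, irreflexive (@sat2 U G eta) }.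

Section Interpret.
Variables (U : Type) (I : simple_interpretation U) (G : colored_graph U).

Definition interpret_vertex : finType := {x : G | sat1 (nu I) x}.

Definition interpret_edge : rel interpret_vertex :=
  fun x y => sat2 (eta I) (val x) (val y).

Lemma interpret_edge_sym : symmetric interpret_edge.
Proof. by move=> x y; apply: eta_sym. Qed.

Lemma interpret_edge_irr : irreflexive interpret_edge.
Proof. by move=> x; apply: eta_irr. Qed.

Definition interpret : sgraph := SGraph interpret_edge_sym interpret_edge_irr.
End Interpret.

Section Copy.
Variables (k : nat) (G : sgraph).

Definition copy_edge : rel (G * 'I_k) := fun x y =>
  ((x.2 == y.2) && edge x.1 y.1) || ((x.1 == y.1) && (x.2 != y.2)).

Lemma copy_edge_sym : symmetric copy_edge.
Proof.
move=> x y; rewrite /copy_edge edge_sym.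
by rewrite (eq_sym x.1) (eq_sym x.2).
Qed.

Lemma copy_edge_irr : irreflexive copy_edge.
Proof. by move=> x; rewrite /copy_edge edge_irr !eqxx. Qed.

Definition copy : sgraph := SGraph copy_edge_sym copy_edge_irr.
End Copy.

Record transduction := Transduction {
  copies : nat;
  copies_gt0 : 0 < copies;
  colors : Type;
  interpretation : simple_interpretation colors }.

(* [transduces T G H] : H belongs to T(G), up to isomorphism. *)
Definition transduces (T : transduction) (G H : sgraph) : Prop :=
  exists c : colors T -> pred (copy (copies T) G),
    graph_iso (interpret (interpretation T) (ColoredGraph c)) H.

Definition transduction_image (T : transduction) (D : graph_class)
    (H : sgraph) : Prop :=
  exists2 G : sgraph, D G & transduces T G H.

Definition is_transduction_of (C D : graph_class) : Prop :=
  exists T : transduction, forall G : sgraph, C G -> transduction_image T D G.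

Definition all_graphs : graph_class :=
  @GraphClass (fun _ => True) (fun _ _ _ _ => I) I.

Section HalfGraph.
Variable n : nat.

(* inl i is a_(i+1) and inr j is b_(j+1). *)
Definition half_edge : rel ('I_n + 'I_n) := fun x y =>
  match x, y with
  | inl i, inr j => i <= j
  | inr j, inl i => i <= j
  | _, _ => false
  end.

Lemma half_edge_sym : symmetric half_edge.
Proof. by move=> [i|i] [j|j]. Qed.

Lemma half_edge_irr : irreflexive half_edge.
Proof. by case. Qed.

Definition half_graph : sgraph := SGraph half_edge_sym half_edge_irr.
End HalfGraph.

Definition is_half_graph (G : sgraph) : Prop :=
  exists n : nat, graph_iso (half_graph n) G.

Lemma is_half_graph_iso G H :
  graph_iso G H -> is_half_graph G -> is_half_graph H.
Proof. by move=> GH [n nG]; exists n; apply: graph_iso_trans GH. Qed.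

Lemma is_half_graph_empty : is_half_graph empty_graph.
Proof.
by exists 0; apply/graph_iso_sym/empty_graph_iso => -[] [].
Qed.

Definition half_graphs : graph_class :=
  GraphClass is_half_graph_iso is_half_graph_empty.

Definition forest_order (T : Type) (le : rel T) : Prop :=
  [/\ reflexive le, antisymmetric le, transitive le
    & forall x y z, le y x -> le z x -> le y z || le z y].

Definition trivially_perfect (G : sgraph) : Prop :=
  exists2 le : rel G, forest_order le
    & forall x y, edge x y = (x != y) && (le x y || le y x).

Lemma trivially_perfect_iso G H :
  graph_iso G H -> trivially_perfect G -> trivially_perfect H.
Proof.
move=> [f [g fK gK] fE] [le [le_refl le_anti le_trans le_lin] leE].
exists (fun x y => le (g x) (g y)); last first.
  by move=> x y; rewrite -{1}(gK x) -{1}(gK y) fE leE (can_eq gK).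
split=> [x|x y /le_anti /(can_inj gK)//|y x z|x y z].
- exact: le_refl.
- exact: le_trans.
- exact: le_lin.
Qed.

Lemma trivially_perfect_empty : trivially_perfect empty_graph.
Proof. by exists (fun _ _ => true); [split; case | case]. Qed.

Definition trivially_perfect_graphs : graph_class :=
  GraphClass trivially_perfect_iso trivially_perfect_empty.

Definition monadically_dependent (C : graph_class) : Prop :=
  ~ is_transduction_of all_graphs C.

Definition monadically_straight (C : graph_class) : Prop :=
  ~ is_transduction_of trivially_perfect_graphs C.

Definition monadically_stable (C : graph_class) : Prop :=
  ~ is_transduction_of half_graphs C.

Section Induced.
Variables (G : sgraph) (P : pred G).

Definition induced_edge : rel {x : G | P x} :=
  fun x y => edge (val x) (val y).

Lemma induced_edge_sym : symmetric induced_edge.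
Proof. by move=> x y; apply: edge_sym. Qed.

Lemma induced_edge_irr : irreflexive induced_edge.
Proof. by move=> x; apply: edge_irr. Qed.

Definition induced : sgraph := SGraph induced_edge_sym induced_edge_irr.
End Induced.

(* The distance from u to v is at most d: some walk from u to v has length
   at most d. *)
Definition dist_le (G : sgraph) (d : nat) (u v : G) : bool :=
  [exists n : 'I_d.+1, [exists p : n.-tuple G,
     path (@edge G) u p && (last u p == v)]].

Definition ball (G : sgraph) (d : nat) (v : G) : sgraph :=
  induced (dist_le d v).

(* The empty graph, which is not a ball, is added since every class
   contains it. *)
Definition in_ball_class (C : graph_class) (d : nat) (H : sgraph) : Prop :=
  graph_iso empty_graph H \/
  exists G : sgraph, C G /\ exists v : G, graph_iso (ball d v) H.

Lemma in_ball_class_iso C d G H :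
  graph_iso G H -> in_ball_class C d G -> in_ball_class C d H.
Proof.
move=> GH [G0|[K [CK [v vG]]]]; first by left; apply: graph_iso_trans GH.
by right; exists K; split=> //; exists v; apply: graph_iso_trans GH.
Qed.

Lemma in_ball_class_empty C d : in_ball_class C d empty_graph.
Proof. by left; apply: empty_graph_iso; case. Qed.

Definition ball_class (C : graph_class) (d : nat) : graph_class :=
  GraphClass (@in_ball_class_iso C d) (@in_ball_class_empty C d).

Definition locally (Pi : graph_class -> Prop) (C : graph_class) : Prop :=
  forall d : nat, Pi (ball_class C d).

(* Main.v *)
(** A ladder [a_i], [b_j] (with [phi (a_i, b_j)] iff [i <= j]) defined by a
   first-order formula [phi] in a colored graph must be concentrated in a ball:
   by locality, vertices far from a set [X] see only boundedly many types of
   vertices of [X], so first some [b_j] is at bounded distance of many [a_i]'s,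
   and then every vertex [y] for which [phi (a_i, y)] is not constant on a
   subfamily of those [a_i]'s having the same type is also close to [b_j].
   To localize a transduction of [K], one therefore transduces a graph in which
   a copy of [K] hangs between any two consecutive rungs of a long ladder;
   trivially perfect graphs are closed under this operation, and half-graphs
   are ladders themselves.  Inside the ball, [phi] is replaced by a truth table,
   stored in colors, in terms of formulas which are evaluated in the ball. *)
Require Import Defs.
From mathcomp Require Import all_boot.

Set Implicit Arguments.
Unset Strict Implicit.
Unset Printing Implicit Defensive.

(** * Environments, substitution and relativization *)

Lemma env_cons0 (T : Type) n (v : T) (e : 'I_n -> T) : env_cons v e ord0 = v.
Proof. by rewrite /env_cons unlift_none. Qed.

Lemma env_consS (T : Type) n (v : T) (e : 'I_n -> T) i :
  env_cons v e (lift ord0 i) = e i.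
Proof. by rewrite /env_cons liftK. Qed.

Lemma env_consP (T : Type) n (P : 'I_n.+1 -> T -> Prop) (v : T) (e : 'I_n -> T) :
  P ord0 v -> (forall i, P (lift ord0 i) (e i)) -> forall i, P i (env_cons v e i).
Proof.
move=> P0 PS i.
by case: (unliftP ord0 i) => [j|] ->; rewrite ?env_consS ?env_cons0.
Qed.

Lemma comp_env_cons (T T' : Type) (h : T -> T') n (v : T) (e : 'I_n -> T) :
  h \o env_cons v e =1 env_cons (h v) (h \o e).
Proof. by move=> i; rewrite /= /env_cons; case: unlift. Qed.

Lemma eq_env_cons (T : Type) n (v : T) (e e' : 'I_n -> T) :
  e =1 e' -> env_cons v e =1 env_cons v e'.
Proof. by move=> ee i; rewrite /env_cons; case: unlift => [j|]. Qed.

Lemma comp_env_pair (T T' : Type) (h : T -> T') (x y : T) :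
  h \o env_cons x (env_cons y (@env_nil T)) =1
  env_cons (h x) (env_cons (h y) (@env_nil T')).
Proof.
move=> i; rewrite comp_env_cons; apply: eq_env_cons => {}i.
by rewrite comp_env_cons; apply: eq_env_cons => -[].
Qed.

Lemma eq_sat U (G : colored_graph U) n (phi : formula U n) (e e' : 'I_n -> G) :
  e =1 e' -> sat phi e = sat phi e'.
Proof.
elim: phi e e' => //=.
- by move=> m i j e e' ee; rewrite !ee.
- by move=> m i j e e' ee; rewrite !ee.
- by move=> m u i e e' ee; rewrite !ee.
- by move=> m f IH e e' ee; rewrite (IH e e').
- by move=> m f IHf g IHg e e' ee; rewrite (IHf e e') // (IHg e e').
- by move=> m f IHf g IHg e e' ee; rewrite (IHf e e') // (IHg e e').
- by move=> m f IH e e' ee; apply: eq_existsb => v; apply/IH/eq_env_cons.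
- by move=> m f IH e e' ee; apply: eq_forallb => v; apply/IH/eq_env_cons.
Qed.

Fixpoint rename U n (phi : formula U n) :
    forall m, ('I_n -> 'I_m) -> formula U m :=
  match phi in formula _ n return forall m, ('I_n -> 'I_m) -> formula U m with
  | Bot _ => fun m _ => Bot U m
  | Eq _ i j => fun m r => Eq U (r i) (r j)
  | Adj _ i j => fun m r => Adj U (r i) (r j)
  | Col _ u i => fun m r => Col u (r i)
  | Neg _ f => fun m r => Neg (rename f r)
  | And _ f g => fun m r => And (rename f r) (rename g r)
  | Or _ f g => fun m r => Or (rename f r) (rename g r)
  | Ex _ f => fun m r => Ex (rename f (env_cons ord0 (lift ord0 \o r)))
  | All _ f => fun m r => All (rename f (env_cons ord0 (lift ord0 \o r)))
  end.

Lemma sat_rename U (G : colored_graph U) n (phi : formula U n) m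
    (r : 'I_n -> 'I_m) (e : 'I_m -> G) :
  sat (rename phi r) e = sat phi (e \o r).
Proof.
have consE k l (r' : 'I_k -> 'I_l) (e' : 'I_l -> G) (v : G) :
    env_cons v e' \o env_cons ord0 (lift ord0 \o r') =1 env_cons v (e' \o r').
  move=> i; rewrite /= {2 3}/env_cons; case: unlift => [j|] /=.
    by rewrite env_consS.
  by rewrite env_cons0.
elim: phi m r e => //=.
- by move=> k f IH m r e; rewrite IH.
- by move=> k f IHf g IHg m r e; rewrite IHf IHg.
- by move=> k f IHf g IHg m r e; rewrite IHf IHg.
- move=> k f IH m r e; apply: eq_existsb => v.
  by rewrite IH; apply/eq_sat/consE.
- move=> k f IH m r e; apply: eq_forallb => v.
  by rewrite IH; apply/eq_sat/consE.
Qed.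

Definition embedding (G H : sgraph) (h : G -> H) : Prop :=
  injective h /\ forall x y, edge (h x) (h y) = edge x y.

Section Relativize.
Variables (U V : Type) (g : U -> V) (u : V).

Fixpoint relativize n (phi : formula U n) : formula V n :=
  match phi with
  | Bot n => Bot V n
  | Eq _ i j => Eq V i j
  | Adj _ i j => Adj V i j
  | Col _ c i => Col (g c) i
  | Neg _ f => Neg (relativize f)
  | And _ f1 f2 => And (relativize f1) (relativize f2)
  | Or _ f1 f2 => Or (relativize f1) (relativize f2)
  | Ex _ f => Ex (And (Col u ord0) (relativize f))
  | All _ f => All (Or (Neg (Col u ord0)) (relativize f))
  end.

Lemma sat_relativize (G : colored_graph U) (H : colored_graph V) (h : G -> H) :
  embedding h -> (forall c x, color (g c) (h x) = color c x) ->
  (forall y, color u y = (y \in codom h)) ->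
  forall n (phi : formula U n) (e : 'I_n -> G),
    sat (relativize phi) (h \o e) = sat phi e.
Proof.
move=> [h_inj hE] hc hu n phi; elim: phi => //=.
- by move=> m i j e; rewrite (inj_eq h_inj).
- by move=> m f IH e; rewrite IH.
- by move=> m f1 IH1 f2 IH2 e; rewrite IH1 IH2.
- by move=> m f1 IH1 f2 IH2 e; rewrite IH1 IH2.
- move=> m f IH e; apply/existsP/existsP => [[y]|[x fx]].
    rewrite env_cons0 hu => /andP[/codomP[x ->] fx]; exists x.
    by rewrite -IH (eq_sat _ (comp_env_cons h x e)).
  exists (h x); rewrite env_cons0 hu codom_f /=.
  by rewrite -(eq_sat _ (comp_env_cons h x e)) IH.
- move=> m f IH e; apply/forallP/forallP => [fy x|fx y].
    move: (fy (h x)); rewrite env_cons0 hu codom_f /=.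
    by rewrite -(eq_sat _ (comp_env_cons h x e)) IH.
  rewrite env_cons0 hu; case: codomP => [[x ->]|//] /=.
  by rewrite -(eq_sat _ (comp_env_cons h x e)) IH.
Qed.
End Relativize.

(** * Transductions built from formulas and colors *)

Section Symmetrize.
Variables (U : Type) (u : U) (psi : formula U 2).

Let i0 : 'I_2 := ord0.
Let i1 : 'I_2 := lift ord0 ord0.

(** A simple interpretation carries proofs that [eta] is symmetric and irreflexive in every colored
    graph. This closure gives any formula these properties and keeps its value wherever it already
    behaves like an adjacency. *)
Definition symmetrized : formula U 2 :=
  And (Neg (Eq U i0 i1)) (And psi (rename psi (@rev_ord 2))).

Lemma sat2_symmetrized (G : colored_graph U) (x y : G) :
  sat2 symmetrized x y = (x != y) && (sat2 psi x y && sat2 psi y x).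
Proof.
rewrite /sat2 /= env_cons0 env_consS env_cons0 sat_rename.
congr (_ && (_ && _)); apply: eq_sat.
apply: (@env_consP _ _ (fun i z => (_ \o _) i = z)) => [|j] /=.
  by rewrite (_ : rev_ord _ = i1) ?env_consS ?env_cons0 //; apply: val_inj.
rewrite (ord1 j) env_cons0 (_ : rev_ord _ = i0) ?env_cons0 //.
exact: val_inj.
Qed.

Lemma symmetrized_sym (G : colored_graph U) : symmetric (@sat2 U G symmetrized).
Proof.
by move=> x y; rewrite !sat2_symmetrized eq_sym (andbC (sat2 psi x y)).
Qed.

Lemma symmetrized_irr (G : colored_graph U) :
  irreflexive (@sat2 U G symmetrized).
Proof. by move=> x; rewrite sat2_symmetrized eqxx. Qed.

Definition marked_interpretation : simple_interpretation U :=
  SimpleInterpretation (Col u (@ord0 0)) symmetrized_sym symmetrized_irr.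
End Symmetrize.

(** The color [u] guesses the vertex set, so it is enough to have a formula that is right about
    adjacency on the image of an injection into the copies. *)
Lemma is_transduction_ofI (C D : graph_class) (k : nat) (U : Type) (u : U)
    (psi : formula U 2) :
  0 < k ->
  (forall H : sgraph, C H -> exists2 G : sgraph, D G &
    exists (c : U -> pred (copy k G)) (f : H -> copy k G),
      [/\ injective f, forall y, c u y = (y \in codom f)
        & forall x y, sat2 (G := ColoredGraph c) psi (f x) (f y) = edge x y]) ->
  is_transduction_of C D.
Proof.
move=> k_gt0 CD; exists (Transduction k_gt0 (marked_interpretation u psi)) => H.
move=> /CD[G DG [c [f [f_inj cu fE]]]]; exists G => //; exists c => /=.
apply: graph_iso_sym.
have fP (x : H) : sat1 (G := ColoredGraph c) (Col u (@ord0 0)) (f x).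
  by rewrite /sat1 /= env_cons0 cu codom_f.
exists (fun x => exist _ (f x) (fP x)).
  apply: inj_card_bij => [x y [/f_inj]//|].
  rewrite card_sig -(card_codom f_inj); apply: subset_leq_card.
  by apply/subsetP => y; rewrite inE /sat1 /= env_cons0 cu.
move=> x y; rewrite -[LHS]/(sat2 (G := ColoredGraph c) (symmetrized psi) (f x) (f y)).
rewrite sat2_symmetrized !fE.
rewrite (inj_eq f_inj) (edge_sym y) andbb.
by case: eqVneq => //= ->; rewrite edge_irr.
Qed.

Lemma transduces_embed (T : transduction) (G H : sgraph) :
  transduces T G H ->
  exists (c : colors T -> pred (copy (copies T) G)) (f : H -> copy (copies T) G),
    injective f /\ forall x y,
    sat2 (G := ColoredGraph c) (eta (interpretation T)) (f x) (f y) = edge x y.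
Proof.
move=> [c /graph_iso_sym[f f_bij fE]]; exists c, (fun x => val (f x)).
by split=> [x y /val_inj/(bij_inj f_bij)//|x y]; rewrite -fE.
Qed.

(** The larger graph marks the induced subgraph by a color, and the edge formula is relativized to
    that color. *)
Lemma transduction_of_hereditary (C D E : graph_class) :
  (forall G : sgraph, D G ->
    exists2 H : sgraph, E H & exists h : G -> H, embedding h) ->
  is_transduction_of C D -> is_transduction_of C E.
Proof.
move=> DE [T TCD].
(* [inr true] will mark the copies of the smaller graph, [inr false] the vertices of the graph to be
   produced. *)
apply: (@is_transduction_ofI C E (copies T) (colors T + bool) (inr false)
  (relativize inl (inr true) (eta (interpretation T)))) => [|K /TCD].
  exact: copies_gt0.
move=> [G /DE[H EH [h0 [h0_inj h0E]]] /transduces_embed[c [f [f_inj fE]]]].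
exists H => //.
pose h (x : copy (copies T) G) : copy (copies T) H := (h0 x.1, x.2).
have h_inj : injective h by move=> [x i] [y j] [/h0_inj-> ->].
pose c' (w : colors T + bool) : pred (copy (copies T) H) :=
  match w with
  | inl w => fun y => [exists x, (h x == y) && c w x]
  | inr true => fun y => y \in codom h
  | inr false => fun y => y \in codom (h \o f)
  end.
exists c', (h \o f); split=> //; first exact: inj_comp.
move=> x y; rewrite -fE /sat2 /=.
rewrite -(@sat_relativize _ _ inl (inr true) (ColoredGraph c) (ColoredGraph c') h) //.
- by apply: eq_sat => i; rewrite comp_env_pair.
- by split=> // -[x1 i] [y1 j]; rewrite /edge /= /copy_edge /= h0E (inj_eq h0_inj).
- move=> w z /=; apply/existsP/idP => [[z' /andP[/eqP/h_inj-> //]]|cz].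
  by exists z; rewrite eqxx.
Qed.

Lemma ball_class_embed (C : graph_class) d (G : sgraph) :
  ball_class C d G ->
  exists2 H : sgraph, C H & exists h : G -> H, embedding h.
Proof.
case=> [/graph_iso_sym[f f_bij fE]|[H [CH [v /graph_iso_sym[f f_bij fE]]]]].
  by exists empty_graph; [exact: class_empty | exists f; split=> //; exact: bij_inj].
exists H => //; exists (fun x => val (f x)).
by split=> [x y /val_inj/(bij_inj f_bij)//|x y]; rewrite -fE.
Qed.

(** * Locality of first-order formulas *)

Section Near.
Variable G : sgraph.
Implicit Types (X : pred G) (d : nat).

Fixpoint near X d : pred G :=
  if d is d'.+1 then
    fun y => near X d' y || [exists z, near X d' z && edge z y]
  else X.

Lemma leq_near X d d' y : d <= d' -> near X d y -> near X d' y.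
Proof.
by move=> /subnK <- Xy; elim: (d' - d) => //= n ->.
Qed.

Lemma near_edge X d x y : near X d x -> edge x y -> near X d.+1 y.
Proof. by move=> Xx xy /=; apply/orP; right; apply/existsP; exists x; rewrite Xx. Qed.

Lemma near_pred1 X d y : near X d y -> exists2 x, X x & near (pred1 x) d y.
Proof.
elim: d y => [|d IH] y /=; first by move=> Xy; exists y => //=.
case/orP => [/IH[x Xx xy]|/existsP[z /andP[/IH[x Xx xz] zy]]]; exists x => //.
  by rewrite xy.
by apply/orP; right; apply/existsP; exists z; rewrite xz.
Qed.
End Near.

Lemma dist_le_edge (G : sgraph) d (u v w : G) :
  dist_le d u v -> edge v w -> dist_le d.+1 u w.
Proof.
move=> /existsP[n /existsP[p /andP[up /eqP pv]]] vw.
have n_lt : n.+1 < d.+2 by rewrite ltnS.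
apply/existsP; exists (Ordinal n_lt); apply/existsP.
by exists [tuple of rcons p w]; rewrite /= rcons_path up pv vw last_rcons /=.
Qed.

Lemma leq_dist_le (G : sgraph) d (u v : G) : dist_le d u v -> dist_le d.+1 u v.
Proof.
move=> /existsP[n]; have n_lt : n < d.+2 by apply: leq_trans (ltn_ord n) _.
by move=> np; apply/existsP; exists (Ordinal n_lt).
Qed.

(** An edge between two copies of one vertex projects to staying in place, so projecting a walk to
    [G] does not lengthen it. *)
Lemma near_copy_dist_le k (G : sgraph) d (v y : copy k G) :
  near (pred1 v) d y -> dist_le d v.1 y.1.
Proof.
elim: d y => [|d IH] y /=.
  move=> /eqP ->; apply/existsP; exists ord0; apply/existsP.
  by exists [tuple]; rewrite /= eqxx.
case/orP => [/IH/leq_dist_le //|/existsP[z /andP[/IH vz]]].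
case/orP => /andP[]; first by move=> _; apply: dist_le_edge vz.
by move=> /eqP <- _; apply: leq_dist_le.
Qed.

Section Locality.
(* [Some i]-colors will store the truth table of a formula, and [None] will
   mark the vertices of the interpreted graph. *)
Variable U : Type.
Definition palette : Type := U + (nat + option nat).

Definition near_color (r : nat) : palette := inr (inl r).

Section Paint.
Variables (G : sgraph) (c : U -> pred G) (X : pred G) (F : option nat -> pred G).

Definition paint : colored_graph palette :=
  @ColoredGraph palette G (fun w =>
    match w with
    | inl u => c u
    | inr (inl r) => near X r
    | inr (inr i) => F i
    end).
End Paint.

(** Table and vertex marks are off. As [confined] leaves these colors of [col] free, a confined
    formula cannot depend on them. *)
Definition unpaint {G : sgraph} (c : U -> pred G) (X : pred G) :=
  paint c X (fun _ => pred0).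

(* [a] has the same meaning in every induced subgraph containing the
   [D]-neighborhood of [X], provided that the colors are inherited. *)
Definition confined D n (a : formula palette n) : Prop :=
  forall (G : sgraph) (c : U -> pred G) (X : pred G) (H : sgraph) (h : H -> G)
    (col : palette -> pred H),
  embedding h ->
  (forall u x, col (inl u) x = c u (h x)) ->
  (forall r x, col (near_color r) x = near X r (h x)) ->
  (forall y, near X D y -> y \in codom h) ->
  forall e : 'I_n -> H,
  sat (G := ColoredGraph col) a e = sat (G := unpaint c X) a (h \o e).

Definition depends_only n (s : pred 'I_n) (a : formula palette n) : Prop :=
  forall (G : sgraph) (c : U -> pred G) (X : pred G) (e e' : 'I_n -> G),
  (forall i, s i -> e i = e' i) ->
  sat (G := unpaint c X) a e = sat (G := unpaint c X) a e'.

(** Positions in [s] may move within radius [d]; the others lie beyond [D] and stay fixed. The gap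
    between the radii separates the two kinds. *)
Definition compatible n (s : pred 'I_n) d D (G : sgraph) (X : pred G)
    (e e' : 'I_n -> G) : Prop :=
  forall i, if s i then near X d (e i) && near X d (e' i)
            else ~~ near X D (e i) && (e i == e' i).

Definition determines n (s : pred 'I_n) d D (T : finType)
    (a : T -> formula palette n) (phi : formula U n) : Prop :=
  forall (G : sgraph) (c : U -> pred G) (X : pred G) (e e' : 'I_n -> G),
  (exists x, X x) -> compatible s d D X e e' ->
  (forall t, sat (G := unpaint c X) (a t) e = sat (G := unpaint c X) (a t) e') ->
  sat (G := ColoredGraph c) phi e = sat (G := ColoredGraph c) phi e'.

Definition Top n : formula palette n := Neg (Bot palette n).

(** The complete type [b] over the family [a], as a single formula. *)
Definition pattern n (T : finType) (a : T -> formula palette n)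
    (b : {ffun T -> bool}) : formula palette n :=
  \big[@And palette n/Top n]_t (if b t then a t else Neg (a t)).

Lemma sat_pattern (G : colored_graph palette) n (T : finType)
    (a : T -> formula palette n) (b : {ffun T -> bool}) (e : 'I_n -> G) :
  sat (pattern a b) e = [forall t, sat (a t) e == b t].
Proof.
rewrite /pattern (big_morph (fun f => sat f e) (id1 := true) (op1 := andb)) //.
by rewrite big_andE; apply: eq_forallb => t /=; case: (b t) => /=; case: sat.
Qed.

Lemma leq_confined D D' n (a : formula palette n) :
  D <= D' -> confined D a -> confined D' a.
Proof.
move=> DD' ha G c X H h col hE colU colN hD; apply: ha => // y Xy.
by apply: hD; apply: leq_near Xy.
Qed.

Lemma confined_pattern D n (T : finType) (a : T -> formula palette n) b :
  (forall t, confined D (a t)) -> confined D (pattern a b).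
Proof.
move=> ha G c X H h col hE colU colN hD e; rewrite !sat_pattern.
by apply: eq_forallb => t; congr (_ == _); apply: ha.
Qed.

Lemma depends_only_pattern n s (T : finType) (a : T -> formula palette n) b :
  (forall t, depends_only s (a t)) -> depends_only s (pattern a b).
Proof.
move=> ha G c X e e' ee; rewrite !sat_pattern.
by apply: eq_forallb => t; congr (_ == _); apply: ha.
Qed.

Definition ex_near r n (a : formula palette n.+1) : formula palette n :=
  Ex (And (Col (near_color r) ord0) a).

Lemma sat_ex_near r n (a : formula palette n.+1) (G : colored_graph palette)
    (e : 'I_n -> G) :
  sat (ex_near r a) e =
  [exists z, color (near_color r) z && sat a (env_cons z e)].
Proof. by apply: eq_existsb => z /=; rewrite env_cons0. Qed.

Lemma ex_nearP r n (a : formula palette n.+1) (G : sgraph) (c : U -> pred G) X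
    (e : 'I_n -> G) :
  reflect (exists2 z : G, near X r z & sat (G := unpaint c X) a (env_cons z e))
    (sat (G := unpaint c X) (ex_near r a) e).
Proof.
rewrite sat_ex_near.
by apply: (iffP existsP) => -[z]; [case/andP; exists z | exists z; apply/andP].
Qed.

(** All candidate witnesses lie in the image of [h], and the inherited color still measures distance
    in the large graph. *)
Lemma confined_ex_near D r n (a : formula palette n.+1) :
  r <= D -> confined D a -> confined D (ex_near r a).
Proof.
move=> rD ha G c X H h col hE colU colN hD e.
have sat_h x : sat (G := ColoredGraph col) a (env_cons x e) =
    sat (G := unpaint c X) a (env_cons (h x) (h \o e)).
  rewrite (ha _ _ _ _ _ col hE colU colN hD).
  exact: (@eq_sat _ (unpaint c X) _ a _ _ (comp_env_cons h x e)).
rewrite sat_ex_near; apply/existsP/ex_nearP => [[x]|[z rz az]].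
  by rewrite [color _ _]colN sat_h => /andP[rx ax]; exists (h x).
have /codomP[x zx] := hD _ (leq_near rD rz); exists x.
by rewrite [color _ _]colN sat_h -zx rz.
Qed.

Lemma depends_only_ex_near r n b (s : pred 'I_n) (a : formula palette n.+1) :
  depends_only (env_cons b s) a -> depends_only s (ex_near r a).
Proof.
move=> ha G c X e e' ee; rewrite !sat_ex_near; apply: eq_existsb => z.
congr (_ && _); apply: ha => i.
by case: (unliftP ord0 i) => [j|] ->; rewrite ?env_consS ?env_cons0 // => /ee.
Qed.

(** Since [a] ignores its first variable, any vertex of [X] can stand for [z]; quantifying over [X]
    removes that variable. *)
Lemma depends_only_drop n (s : pred 'I_n) (a : formula palette n.+1)
    (G : sgraph) (c : U -> pred G) (X : pred G) (e : 'I_n -> G) (z : G) :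
  depends_only (env_cons false s) a -> (exists x, X x) ->
  sat (G := unpaint c X) a (env_cons z e) =
  sat (G := unpaint c X) (ex_near 0 a) e.
Proof.
move=> ha [x Xx].
have swap z' : sat (G := unpaint c X) a (env_cons z e) =
               sat (G := unpaint c X) a (env_cons z' e).
  by apply: ha => i; case: (unliftP ord0 i) => [j|] ->; rewrite ?env_consS ?env_cons0.
apply/idP/ex_nearP => [az|[z' _]]; last by rewrite -swap.
by exists x; rewrite // -swap.
Qed.

Lemma compatible_sym n (s : pred 'I_n) d D (G : sgraph) (X : pred G) e e' :
  compatible s d D X e e' -> compatible s d D X e' e.
Proof.
move=> ee i; move: (ee i); case: (s i); first by rewrite andbC.
by case/andP => ? /eqP <-; rewrite eqxx andbT.
Qed.

Lemma leq_compatible n (s : pred 'I_n) d d' D D' (G : sgraph) (X : pred G) e e' :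
  d <= d' -> D' <= D -> compatible s d D X e e' -> compatible s d' D' X e e'.
Proof.
move=> dd' DD' ee i; move: (ee i); case: (s i).
  by case/andP => /(leq_near dd') -> /(leq_near dd').
by case/andP => nD ->; rewrite andbT; apply: contra nD; apply: leq_near.
Qed.

Lemma compatible_cons n b (s : pred 'I_n) d D (G : sgraph) (X : pred G) e e' z z' :
  compatible s d D X e e' ->
  (if b then near X d z && near X d z' else ~~ near X D z && (z == z')) ->
  compatible (env_cons b s) d D X (env_cons z e) (env_cons z' e').
Proof.
move=> ee zz i.
by case: (unliftP ord0 i) => [j|] ->; rewrite ?env_consS ?env_cons0.
Qed.

Definition local_at n (phi : formula U n) (s : pred 'I_n) d D (T : finType)
    (a : T -> formula palette n) : Prop :=
  [/\ d <= D, forall t, confined D (a t), forall t, depends_only s (a t)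
    & determines s d D a phi].

(** Radius [d.+1] suits atoms: a vertex beyond it is neither equal nor adjacent to one within
    [d]. *)
Lemma local_atom n (phi : formula U n) (a : formula palette n) (s : pred 'I_n) d :
  confined d.+1 a -> depends_only s a -> determines s d d.+1 (fun _ : unit => a) phi ->
  exists D (T : finType) (b : T -> formula palette n), local_at phi s d D b.
Proof. by move=> ha sa da; exists d.+1, unit, (fun=> a); split. Qed.

(** Asking only that the value of [phi] be a function of the other two covers every connective,
    negation included by repeating its argument. *)
Lemma local_binary n (phi1 phi2 phi : formula U n) (s : pred 'I_n) d :
  (forall (G : sgraph) (c : U -> pred G) (e e' : 'I_n -> G),
    sat (G := ColoredGraph c) phi1 e = sat (G := ColoredGraph c) phi1 e' ->
    sat (G := ColoredGraph c) phi2 e = sat (G := ColoredGraph c) phi2 e' ->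
    sat (G := ColoredGraph c) phi e = sat (G := ColoredGraph c) phi e') ->
  (exists D (T : finType) (b : T -> formula palette n), local_at phi1 s d D b) ->
  (exists D (T : finType) (b : T -> formula palette n), local_at phi2 s d D b) ->
  exists D (T : finType) (b : T -> formula palette n), local_at phi s d D b.
Proof.
move=> phiE [D1 [T1 [a1 [dD1 c1 s1 det1]]]] [D2 [T2 [a2 [dD2 c2 s2 det2]]]].
exists (maxn D1 D2), (T1 + T2)%type,
  (fun t => match t with inl t => a1 t | inr t => a2 t end); split.
- by rewrite leq_max dD1.
- by case=> t; [apply: leq_confined (c1 t) | apply: leq_confined (c2 t)];
    rewrite leq_max leqnn ?orbT.
- by case.
- move=> G c X e e' X0 ee at_; apply: phiE.
    apply: (det1 _ _ X) => // [|t]; last exact: (at_ (inl t)).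
    by apply: leq_compatible ee; rewrite // leq_max leqnn.
  apply: (det2 _ _ X) => // [|t]; last exact: (at_ (inr t)).
  by apply: leq_compatible ee; rewrite // leq_max leqnn orbT.
Qed.

(* A quantified vertex is either close to [X], and then counts as a near
   variable for the radius obtained in the other case, or far from [X], and
   then counts as a far one; far variables do not affect the formulas [a]. *)
Lemma local_quantifier n (f : formula U n.+1) (phi : formula U n) (s : pred 'I_n) d :
  (forall (G : sgraph) (c : U -> pred G) (e e' : 'I_n -> G),
    (forall z, exists z', sat (G := ColoredGraph c) f (env_cons z e) =
                          sat (G := ColoredGraph c) f (env_cons z' e')) ->
    (forall z', exists z, sat (G := ColoredGraph c) f (env_cons z e) =
                          sat (G := ColoredGraph c) f (env_cons z' e')) ->
    sat (G := ColoredGraph c) phi e = sat (G := ColoredGraph c) phi e') ->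
  (forall s' d', exists D (T : finType) (b : T -> formula palette n.+1),
    local_at f s' d' D b) ->
  exists D (T : finType) (b : T -> formula palette n), local_at phi s d D b.
Proof.
move=> phiE IH.
have [D1 [T1 [a1 [dD1 c1 s1 det1]]]] := IH (env_cons false s) d.
have [D2 [T2 [a2 [dD2 c2 s2 det2]]]] := IH (env_cons true s) D1.
(* The right summand records which complete types are realized by a near vertex. *)
pose a (t : T1 + {ffun T2 -> bool}) :=
  match t with
  | inl t => ex_near 0 (a1 t)
  | inr b => ex_near D1 (pattern a2 b)
  end.
(* Half of a back-and-forth argument; exchanging [e] and [e'] gives the other half. *)
have forth (G : sgraph) (c : U -> pred G) (X : pred G) (e e' : 'I_n -> G) :
    (exists x, X x) -> compatible s d D2 X e e' ->
    (forall t, sat (G := unpaint c X) (a t) e = sat (G := unpaint c X) (a t) e') ->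
    forall z, exists z', sat (G := ColoredGraph c) f (env_cons z e) =
                         sat (G := ColoredGraph c) f (env_cons z' e').
  move=> X0 ee at_ z; case: (boolP (near X D1 z)) => [z_near|z_far].
    pose b := [ffun t => sat (G := unpaint c X) (a2 t) (env_cons z e)].
    have : sat (G := unpaint c X) (a (inr b)) e.
      apply/ex_nearP; exists z => //; rewrite sat_pattern.
      by apply/forallP => t; rewrite ffunE.
    rewrite at_ => /ex_nearP[z' z'_near]; rewrite sat_pattern => /forallP zz.
    exists z'; apply: (det2 _ _ X) => // [|t].
      apply: compatible_cons; last by rewrite z_near.
      exact: leq_compatible ee.
    by rewrite (eqP (zz t)) ffunE.
  exists z; apply: (det1 _ _ X) => // [|t].
    apply: compatible_cons; last by rewrite z_far eqxx.
    exact: leq_compatible ee.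
  by rewrite !(depends_only_drop _ _ _ (s1 t) X0) (at_ (inl t)).
exists D2, (T1 + {ffun T2 -> bool})%type, a; split.
- exact: leq_trans dD2.
- case=> t; apply: confined_ex_near => //; last exact: confined_pattern.
  exact: leq_confined (c1 t).
- case=> t; first exact: depends_only_ex_near (s1 t).
  exact/depends_only_ex_near/depends_only_pattern.
- move=> G c X e e' X0 ee at_; apply: phiE; first exact: (forth _ _ X).
  move=> z'; have [] := forth _ c X e' e X0 (compatible_sym ee) _ z' => //.
  by move=> z ->; exists z.
Qed.

(* The radius and the formulas depend on [phi] only: in every graph, the truth
   of [phi] is determined by its far arguments together with finitely many
   formulas about its near arguments, evaluated in a neighborhood of [X]. *)
Lemma locality n (phi : formula U n) (s : pred 'I_n) d :
  exists D (T : finType) (a : T -> formula palette n), local_at phi s d D a.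
Proof.
elim: phi s d => {n}.
- by move=> n s d; apply: (@local_atom _ _ (Bot _ n)).
- move=> n i j s d.
  (* Only near-near atoms need a formula: mixed ones are false, and far arguments are the same in
     both environments. *)
  apply: (@local_atom _ _ (if s i && s j then Eq _ i j else Bot _ n)).
  + case: ifP => // _ G c X H h col [h_inj _] _ _ _ e.
    by rewrite /= (inj_eq h_inj).
  + case: ifP => // /andP[si sj] G c X e e' ee.
    by rewrite /= !ee.
  move=> G c X e e' _ ee /(_ tt) /=; move: (ee i) (ee j).
  have ne u v : near X d u -> ~~ near X d.+1 v -> (u == v) = false.
    by move=> du; apply: contraNF => /eqP <-; apply: leq_near du.
  case: (s i) (s j) => -[] /= /andP[i1 /[dup] i2 /eqP i3] /andP[j1 /[dup] j2 /eqP j3] //.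
  + by move=> _; rewrite -j3 !ne.
  + by move=> _; rewrite -i3 !(eq_sym (e i)) !ne.
  + by rewrite i3 j3.
- move=> n i j s d.
  apply: (@local_atom _ _ (if s i && s j then Adj _ i j else Bot _ n)).
  + case: ifP => // _ G c X H h col [_ hE] _ _ _ e.
    by rewrite /= hE.
  + case: ifP => // /andP[si sj] G c X e e' ee.
    by rewrite /= !ee.
  move=> G c X e e' _ ee /(_ tt) /=; move: (ee i) (ee j).
  have ne u v : near X d u -> ~~ near X d.+1 v -> edge u v = false.
    by move=> du; apply: contraNF; apply: near_edge du.
  case: (s i) (s j) => -[] /= /andP[i1 /[dup] i2 /eqP i3] /andP[j1 /[dup] j2 /eqP j3] //.
  + by move=> _; rewrite -j3 !ne.
  + by move=> _; rewrite -i3 !(edge_sym (e i)) !ne.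
  + by rewrite i3 j3.
- move=> n u i s d.
  apply: (@local_atom _ _ (if s i then Col (inl u) i else Bot _ n)).
  + by case: ifP => // _ G c X H h col _ colU _ _ e; rewrite /= colU.
  + by case: ifP => // si G c X e e' ee; rewrite /= !ee.
  move=> G c X e e' _ ee /(_ tt) /=; move: (ee i).
  by case: (s i) => //= /andP[_ /eqP ->].
- move=> n f IH s d; have := IH s d => IHs.
  by apply: (local_binary _ IHs IHs) => G c e e' /= ->.
- move=> n f IHf g IHg s d.
  by apply: (local_binary _ (IHf s d) (IHg s d)) => G c e e' /= -> ->.
- move=> n f IHf g IHg s d.
  by apply: (local_binary _ (IHf s d) (IHg s d)) => G c e e' /= -> ->.
- move=> n f IH s d; apply: local_quantifier IH => G c e e' forth back /=.
  apply/existsP/existsP => -[z fz].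
    by have [z' zz'] := forth z; exists z'; rewrite -zz'.
  by have [z' zz'] := back z; exists z'; rewrite zz'.
- move=> n f IH s d; apply: local_quantifier IH => G c e e' forth back /=.
  apply/forallP/forallP => fz z.
    by have [z' <-] := back z.
  by have [z' ->] := forth z.
Qed.
End Locality.

(** * Ladders *)

(** This is locality with the first variable near and the second far: the type of [x] is the truth
    table of the local formulas, so the number of types is independent of [G]. *)
Lemma finitely_many_far_types U (phi : formula U 2) d :
  exists D (T : finType), d <= D /\
  forall (G : sgraph) (c : U -> pred G) (X : pred G), (exists x, X x) ->
  exists type : G -> T, forall x x' y,
    near X d x -> near X d x' -> ~~ near X D y -> type x = type x' ->
    sat2 (G := ColoredGraph c) phi x y = sat2 (G := ColoredGraph c) phi x' y.
Proof.
pose s : pred 'I_2 := env_cons true (env_cons false (@env_nil bool)).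
have [D [T [a [dD _ sa da]]]] := locality phi s d.
exists D, {ffun T -> bool}; split=> // G c X X0.
pose pair (x y : G) := env_cons x (env_cons y (@env_nil G)).
(* The second [x] is a filler, as these formulas do not read the far variable. *)
exists (fun x => [ffun t => sat (G := unpaint c X) (a t) (pair x x)]).
move=> x x' y dx dx' Dy /ffunP xx'.
have fst_sat z t : sat (G := unpaint c X) (a t) (pair z y) =
                   sat (G := unpaint c X) (a t) (pair z z).
  apply: sa => i; case: (unliftP ord0 i) => [j|] ->; last by rewrite /pair !env_cons0.
  by rewrite (ord1 j) /s env_consS env_cons0.
apply: (da _ c X) => // [|t]; last by have := xx' t; rewrite !ffunE !fst_sat.
apply: compatible_cons; last by rewrite dx dx'.
by apply: compatible_cons => [[] //|]; rewrite Dy eqxx.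
Qed.

Lemma pigeonhole_card (A B : finType) (f : A -> B) (S : {set A}) m :
  #|B| * m < #|S| -> exists b, m < #|[set x in S | f x == b]|.
Proof.
move=> BmS; apply/existsP; apply: contraLR BmS.
rewrite negb_exists -leqNgt => /forallP small.
rewrite -sum1_card (partition_big f xpredT) //= -sum_nat_const.
apply: leq_sum => b _; have := small b.
rewrite -leqNgt; apply: leq_trans; rewrite -sum1_card.
by under [leqRHS]eq_bigl do rewrite inE.
Qed.

Lemma increasing_enum n m (S : {set 'I_n}) :
  m <= #|S| -> exists2 i : 'I_m -> 'I_n,
    {homo i : x y / x < y} & forall x, i x \in S.
Proof.
move=> mS; case: m mS => [|m] mS;
  first by exists (fun x : 'I_0 => match notF (ltn_ord x) with end) => -[].
have [x0 _] : exists x, x \in S by apply/card_gt0P; apply: leq_trans mS.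
have sz (x : 'I_m.+1) : x < size (enum S) by rewrite -cardE (leq_trans (ltn_ord x)).
exists (fun x => nth x0 (enum S) x) => [x y xy|x]; last by rewrite -mem_enum mem_nth.
have S_sorted : sorted ltn (map val (enum S)).
  apply: (@subseq_sorted _ _ ltn_trans _ (iota 0 n)); last exact: iota_ltn_sorted.
  by rewrite -val_enum_ord map_subseq // {1}/enum_mem enumT filter_subseq.
have := sorted_ltn_nth ltn_trans 0 S_sorted x y.
rewrite !inE size_map !sz => /(_ isT isT xy).
by rewrite !(nth_map x0).
Qed.

Lemma ladder_localizes U (phi : formula U 2) :
  exists D, forall m, exists n, forall (G : sgraph) (c : U -> pred G),
  let R := sat2 (G := ColoredGraph c) phi in
  symmetric R -> forall a b : 'I_n -> G, (forall i j, R (a i) (b j) = (i <= j)) ->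
  exists (v : G) (iota : 'I_m -> 'I_n),
    {homo iota : x y / x < y} /\
    forall y, (exists i, y = a (iota i)) \/
              (exists i i', R (a (iota i)) y != R (a (iota i')) y) ->
    near (pred1 v) D y.
Proof.
have [D0 [T0 [_ far0]]] := finitely_many_far_types phi 0.
have [D [T [D0D far]]] := finitely_many_far_types phi D0.
exists D => m.
pose t := #|T0|.+1; pose n0 := #|T| * m; pose w := (t * n0).+1.
exists (t * w).+1 => G c R Rsym a b Rab.
pose step (l : 'I_t) : 'I_(t * w).+1 := inord (l * w).
have stepE (l : 'I_t) : step l = l * w :> nat.
  by rewrite inordK // ltnS leq_mul2r ltnW ?orbT.
(* There are more elements in [B] than types, so two of them are not separated
   by vertices far from [B]; but every [a i] in the block between these two
   separates them, hence this whole block lies near [B]. *)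
pose B : pred G := [pred y | [exists l, y == b (step l)]].
have B0 : exists x, B x by exists (b (step ord0)); apply/existsP; exists ord0.
have [type typeP] := far0 G c B B0.
have Bstep l : B (b (step l)) by apply/existsP; exists l.
have [l [l' [ll' same_type]]] : exists l l' : 'I_t,
    l < l' /\ type (b (step l)) = type (b (step l')).
  have /injectivePn[l [l' ll' E]] : ~~ injectiveb (fun l => type (b (step l))).
    apply: contraL (ltnSn #|T0|) => /injectiveP/leq_card.
    by rewrite card_ord -leqNgt.
  by case: (ltngtP l l') ll' => [? _|? _|/ord_inj ->]; rewrite ?eqxx //;
    [exists l, l' | exists l', l].
pose block (r : 'I_w) : 'I_(t * w).+1 := inord (l * w + r.+1).
have block_le (r : 'I_w) : l * w + r.+1 <= l' * w.
  rewrite (leq_trans _ (_ : l.+1 * w <= _)) ?leq_mul2r ?ll' ?orbT //.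
  by rewrite mulSn addnC leq_add2r.
have blockE r : block r = l * w + r.+1 :> nat.
  by rewrite inordK // ltnS (leq_trans (block_le r)) // leq_mul2r ltnW ?orbT.
have block_near r : near B D0 (a (block r)).
  apply: contraT => r_far.
  have := typeP _ _ _ (Bstep l) (Bstep l') r_far same_type.
  rewrite -!/(R _ _) !(Rsym _ (a _)) !Rab !stepE blockE block_le.
  by rewrite leqNgt -addSnnS ltnS leq_addr.
have /fin_all_exists[p pP] r : exists l1, near (pred1 (b (step l1))) D0 (a (block r)).
  by have [y /existsP[l1 /eqP ->]] := near_pred1 (block_near r); exists l1.
have [|l1] := @pigeonhole_card _ _ p [set: 'I_w] n0.
  by rewrite cardsT !card_ord.
set v := b (step l1) => many; exists v.
pose S := [set i | near (pred1 v) D0 (a i)].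
have many_near : n0 < #|S|.
  apply: leq_trans many _.
  have block_inj : injective block.
    move=> r r' /(congr1 val); rewrite /= !blockE => /addnI[]; exact: val_inj.
  rewrite -(card_imset _ block_inj); apply: subset_leq_card.
  apply/subsetP => i /imsetP[r]; rewrite !inE => /eqP p_r ->.
  by rewrite /v -p_r.
have [|type' type'P] := far G c (pred1 v); first by exists v => /=.
have [tau many_tau] := @pigeonhole_card _ _ (fun i => type' (a i)) S _ many_near.
have [iota iota_mono iotaS] := increasing_enum (ltnW many_tau).
have iota_near i : near (pred1 v) D0 (a (iota i)).
  by have := iotaS i; rewrite !inE => /andP[].
exists iota; split=> // y [[i ->]|[i [i' ne]]]; first exact: leq_near (iota_near i).
apply: contraNT ne => y_far; apply/eqP/type'P => //.
by have := iotaS i; have := iotaS i'; rewrite !inE => /andP[_ /eqP ->] /andP[_ /eqP ->].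
Qed.

Definition nonconstant_on (G : sgraph) m (a : 'I_m -> G) (y : G) : Prop :=
  exists i i', edge (a i) y != edge (a i') y.

Definition rich_in_ladders (C : graph_class) : Prop :=
  forall K : sgraph, C K -> K -> exists m, forall n,
  exists2 H : sgraph, C H & exists a b : 'I_n -> H,
    (forall i j, edge (a i) (b j) = (i <= j)) /\
    forall iota : 'I_m -> 'I_n, {homo iota : x y / x < y} ->
    exists2 f : K -> H, embedding f &
      forall x, (exists i, f x = a (iota i)) \/ nonconstant_on (a \o iota) (f x).

Lemma sat_bigor U (G : colored_graph U) n (T : finType) (f : T -> formula U n)
    (e : 'I_n -> G) :
  sat (\big[@Or U n/Bot U n]_t f t) e = [exists t, sat (f t) e].
Proof.
by rewrite (big_morph (fun f => sat f e) (id1 := false) (op1 := orb)) // big_orE.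
Qed.

Lemma localize_transduction (C E : graph_class) :
  rich_in_ladders C -> is_transduction_of C E ->
  exists d, is_transduction_of C (ball_class E d).
Proof.
move=> rich [T TE].
set k := copies T; set U := colors T; set phi := eta (interpretation T).
have [D1 ladder] := ladder_localizes phi.
have [D [W [al [D1D al_conf _ al_det]]]] := locality phi predT D1.
exists D.
pose psi : formula (palette U) 2 :=
  \big[@Or _ _/Bot _ _]_(b : {ffun W -> bool})
    And (Col (inr (inr (Some (enum_rank b : nat)))) ord0) (pattern al b).
apply: (@is_transduction_ofI _ _ k _ (inr (inr None)) psi) => [|K CK].
  exact: copies_gt0.
have [q0 _|K0] := pickP (fun _ : K => true); last first.
  exists empty_graph; first exact: class_empty.
  exists (fun _ _ => false), (fun x => match notF (esym (K0 x)) with end).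
  by split=> [x|[[]]|x]; have := K0 x.
have [m /= HC] := rich K CK q0; have [n ladder_n] := ladder m.
have [H CH [a [b [ab HK]]]] := HC n.
have [G EG /transduces_embed[c [g [g_inj gE]]]] := TE _ CH.
have phi_sym : symmetric (sat2 (G := ColoredGraph c) phi) by apply: eta_sym.
have [|v [iota [iota_mono iota_near]]] :=
  ladder_n _ c phi_sym (g \o a) (g \o b); first by move=> i j; rewrite /= gE.
have [f [f_inj fE] f_iota] := HK iota iota_mono.
have gf_near x : near (pred1 v) D1 (g (f x)).
  apply: iota_near; case: (f_iota x) => [[i ->]|[i [i' ii']]]; [left|right].
    by exists i.
  by exists i, i'; rewrite /= !gE.
pose h (x : copy k (ball D v.1)) : copy k G := (val x.1, x.2).
have h_emb : embedding h.
  split=> [[x i] [y j] [/val_inj -> ->] //|[x i] [y j]].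
  by rewrite /edge /= /copy_edge /= (inj_eq val_inj).
have h_near y : near (pred1 v) D y -> y \in codom h.
  case: y => y i /near_copy_dist_le /= vy.
  by apply/codomP; exists (exist _ y vy, i).
exists (ball D v.1).
  by right; exists G; split=> //; exists v.1; exists id; [exists id|].
have /fin_all_exists[f0 f0E] x : exists z, h z = g (f x).
  by have /codomP[z ->] := h_near _ (leq_near D1D (gf_near x)); exists z.
pose X : pred (copy k G) := pred1 v.
have X0 : exists x, X x by exists v; rewrite /X /=.
pose pair (H' : sgraph) (x y : H') := env_cons x (env_cons y (@env_nil H')).
pose bits x y := [ffun t => sat (G := unpaint c X) (al t) (pair _ x y)].
have bitsP x y x' y' : near X D1 x -> near X D1 y -> near X D1 x' -> near X D1 y' ->
    bits x y = bits x' y' -> sat2 (G := ColoredGraph c) phi x y =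
                             sat2 (G := ColoredGraph c) phi x' y'.
  move=> dx dy dx' dy' /ffunP xy; apply: (al_det _ c X) => // [|t].
    move=> i /=; case: (unliftP ord0 i) => [j|] ->.
      by rewrite /pair !env_consS (ord1 j) !env_cons0 dy dy'.
    by rewrite !env_cons0 dx dx'.
  by have := xy t; rewrite !ffunE.
pose realized (b : {ffun W -> bool}) := [exists x, exists y,
  [&& near X D1 x, near X D1 y, bits x y == b & sat2 (G := ColoredGraph c) phi x y]].
pose col (w : palette U) : pred (copy k (ball D v.1)) :=
  match w with
  | inl u => fun z => c u (h z)
  | inr (inl r) => fun z => near X r (h z)
  | inr (inr (Some i)) => fun _ => [exists b, (i == enum_rank b) && realized b]
  | inr (inr None) => fun z => z \in codom f0
  end.
exists col, f0; split=> // [x y /(congr1 h)|x y]; first by rewrite !f0E => /g_inj/f_inj.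
have pattern_bits z : sat (G := ColoredGraph col) (pattern al z) (pair _ (f0 x) (f0 y)) =
                      (bits (g (f x)) (g (f y)) == z).
  rewrite sat_pattern; apply/forallP/eqP => [at_|<- t].
    apply/ffunP => t; rewrite -(eqP (at_ t)) ffunE (al_conf t _ c X _ h) //.
    by apply: eq_sat => i; rewrite comp_env_pair !f0E.
  rewrite ffunE (al_conf t _ c X _ h) //; apply/eqP.
  by apply: eq_sat => i; rewrite comp_env_pair !f0E.
rewrite /sat2 sat_bigor -fE -gE; apply/existsP/idP => [[b']|xy].
  rewrite [sat _ _](congr2 andb erefl (pattern_bits b')) /=.
  case/andP => /existsP[b0 /andP[/eqP/ord_inj/enum_rank_inj <-]].
  case/existsP => x' /existsP[y' /and4P[dx' dy' /eqP <- xy']] /eqP.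
  by move=> /bitsP->.
exists (bits (g (f x)) (g (f y))).
rewrite [sat _ _](congr2 andb erefl (pattern_bits _)) eqxx andbT /=.
apply/existsP; exists (bits (g (f x)) (g (f y))); rewrite eqxx /=.
apply/existsP; exists (g (f x)); apply/existsP; exists (g (f y)).
by rewrite !gf_near eqxx.
Qed.

(** * Classes rich in ladders *)

Section Comb.
Variables (n : nat) (K : sgraph).

Definition comb_edge : rel ('I_n + 'I_n * K) := fun x y =>
  match x, y with
  | inl i, inl j => i != j
  | inl i, inr (j, _) => i <= j
  | inr (j, _), inl i => i <= j
  | inr (i, p), inr (j, q) => (i == j) && edge p q
  end.

Lemma comb_edge_sym : symmetric comb_edge.
Proof.
move=> [i|[i p]] [j|[j q]] //=; first by rewrite eq_sym.
by rewrite eq_sym edge_sym.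
Qed.

Lemma comb_edge_irr : irreflexive comb_edge.
Proof. by move=> [i|[i p]] /=; rewrite ?eqxx ?edge_irr ?andbF. Qed.

Definition comb : sgraph := SGraph comb_edge_sym comb_edge_irr.

Definition comb_le (le : rel K) : rel comb := fun x y =>
  match x, y with
  | inl i, inl j => i <= j
  | inl i, inr (j, _) => i <= j
  | inr _, inl _ => false
  | inr (i, p), inr (j, q) => (i == j) && le p q
  end.

Lemma comb_trivially_perfect : trivially_perfect K -> trivially_perfect comb.
Proof.
move=> [le [le_refl le_anti le_trans le_lin] leE].
exists (comb_le le); first split.
- by move=> [i|[i p]] /=; rewrite ?leqnn // eqxx le_refl.
- move=> [i|[i p]] [j|[j q]] //=; rewrite ?andbF //; first by move=> /anti_leq/ord_inj ->.
  by case/andP => /andP[/eqP -> pq] /andP[_ qp]; rewrite (le_anti p q) ?pq.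
- move=> [i|[i p]] [j|[j q]] [l|[l r]] //=; try exact: leq_trans.
    by move=> ij /andP[/eqP <-].
  by case/andP => /eqP <- pq /andP[/eqP <- qr]; rewrite eqxx (le_trans _ _ _ pq qr).
- move=> [i|[i p]] [j|[j q]] [l|[l r]] //=; try by rewrite leq_total.
  + by move=> ji /andP[/eqP -> _]; rewrite ji.
  + by move=> /andP[/eqP -> _] ->; rewrite ?orbT.
  + by case/andP => /eqP -> qp /andP[/eqP -> rp]; rewrite eqxx (le_lin p).
- move=> [i|[i p]] [j|[j q]] /=; rewrite ?orbF //.
  + by rewrite leq_total andbT.
  + rewrite leE (inj_eq (@inr_inj _ _)) xpair_eqE (eq_sym j).
    by case: eqVneq.
Qed.
End Comb.

Lemma rich_comb (C : graph_class) :
  (forall n K, C K -> C (comb n K)) -> rich_in_ladders C.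
Proof.
move=> Ccomb K CK q0; exists 2 => n; exists (comb n K); first exact: Ccomb.
exists inl, (fun j => inr (j, q0)); split=> // iota iota_mono.
exists (fun x => inr (iota ord0, x)).
  by split=> [x y [] //|x y]; rewrite {1}/edge /= eqxx.
move=> x; right; exists ord0, ord_max.
by rewrite /edge /= leqnn leqNgt iota_mono.
Qed.

Lemma rich_half_graphs : rich_in_ladders half_graphs.
Proof.
move=> K [m /graph_iso_sym[g /bij_inj g_inj gE]] _; exists m.+1 => n.
exists (half_graph n); first by exists n; exists id => //; exists id.
exists inl, inr; split=> // iota iota_mono.
have iotaE x y : (iota x <= iota y) = (x <= y).
  have [xy|yx|/ord_inj ->] := ltngtP x y; last by rewrite leqnn.
    by rewrite ltnW ?iota_mono.
  by apply/negbTE; rewrite -ltnNge iota_mono.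
pose wide : 'I_m -> 'I_m.+1 := widen_ord (leqnSn m).
have iota_wide_inj : injective (iota \o wide).
  move=> x y /= E; have := iotaE (wide x) (wide y); have := iotaE (wide y) (wide x).
  by rewrite E leqnn /= => yx xy; apply/val_inj/eqP; rewrite eqn_leq -xy -yx.
pose f (x : half_graph m) : half_graph n :=
  match x with inl i => inl (iota (wide i)) | inr j => inr (iota (wide j)) end.
have f_inj : injective f by move=> [i|i] [j|j] //= [/iota_wide_inj ->].
exists (f \o g).
  split=> [|x y]; first exact: inj_comp.
  by rewrite -gE /=; case: (g x) (g y) => i [] j //=; rewrite /edge /= iotaE.
move=> x /=; case: (g x) => i /=; first by left; exists (wide i).
right; exists ord0, ord_max.
by rewrite /edge /= !iotaE /= [m <= _]leqNgt ltn_ord.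
Qed.

Lemma locally_not_transduction_of (C E : graph_class) : rich_in_ladders C ->
  locally (fun D => ~ is_transduction_of C D) E <-> ~ is_transduction_of C E.
Proof.
move=> rich; split=> [loc /(localize_transduction rich)[d]|noE d]; first exact: loc.
by move=> trans; apply/noE/(transduction_of_hereditary _ trans)/ball_class_embed.
Qed.

Theorem theorem19p9 (C : graph_class) :
  (locally monadically_dependent C <-> monadically_dependent C) /\
  (locally monadically_straight C <-> monadically_straight C) /\
  (locally monadically_stable C <-> monadically_stable C).
Proof.
split; last split; apply: locally_not_transduction_of.
- exact: rich_comb.
- exact/rich_comb/comb_trivially_perfect.
- exact: rich_half_graphs.
Qed.
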